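(* For any $t \ge 0$, $$\mathbb{P}_{\kappa,n}\Big( \frac{1}{n} \sum_{i = 1}^n \omega_i - \mathbb{E}_{\kappa,n} \omega_1 \ge t \Big) \le \exp\Big( - \frac{n t^2}{4\big(1- \frac n N \big)|\mathcal{X}|^2} \Big).$$ The same estimate holds for $\mathbb{P}_{\kappa,n}\big( \frac{1}{n} \sum_{i = 1}^n \omega_i - \mathbb{E}_{\kappa,n} \omega_1 \le -t\big)$.
   Context: Let $L \ge 2$ be an integer, $\kappa = (\kappa_1,\ldots,\kappa_L)$ a vector of positive integers, $N = \kappa_1 + \cdots + \kappa_L$, and $\mathcal{X} = \{x_1,\ldots,x_L\} \subset \mathbb{R}$ a set of $L$ distinct reals with $x_1 < \cdots < x_L$; $|\mathcal{X}| := x_L - x_1$. The multislice is $\Omega_\kappa = \{\omega \in \mathcal{X}^N : \#\{i : \omega_i = x_\ell\} = \kappa_\ell \text{ for } \ell = 1,\ldots,L\}$, with uniform distribution $\mathbb{P}_\kappa$. For $1 \le n \le N$ let $pr_n$ be the projection onto the first $n$ coordinates, $\Omega_{\kappa,n} := pr_n(\Omega_\kappa)$, and let $\mathbb{P}_{\kappa,n}$ be the push-forward of $\mathbb{P}_\kappa$ under $pr_n$, with expectation $\mathbb{E}_{\kappa,n}$; $\omega = (\omega_1,\ldots,\omega_n)$ is distributed according to $\mathbb{P}_{\kappa,n}$. If $n = N$, the right-hand side is read as $0$ for $t > 0$ and as $1$ for $t = 0$. *)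

(* Defs.v *)
From HB Require Import structures.
From mathcomp Require Import all_boot all_order all_algebra.
From mathcomp Require Import reals sequences exp.

Set Implicit Arguments.
Unset Strict Implicit.
Unset Printing Implicit Defensive.

Import Order.TTheory GRing.Theory Num.Theory.

Local Open Scope ring_scope.

(* The points x_1 < ... < x_L are given by a function x : 'I_L -> R, with
   x_(l+1) = x l. *)
Section Alphabet.
Variables (R : realType) (L : nat).
Implicit Type x : 'I_L -> R.

(* The finite set X = {x_1, ..., x_L}, as a finite subtype of R; its elements
   are sent back to R by val. *)
Definition alphabet x := seq_sub (codom x).

(* |X| = x_L - x_1 *)
Definition spread (L_ge2 : (2 <= L)%N) x : R :=
  let L_gt0 : (0 < L)%N := ltnW L_ge2 in
  let last_lt : (L.-1 < L)%N := etrans (ltn_predL L) L_gt0 in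
  x (Ordinal last_lt) - x (Ordinal L_gt0).

End Alphabet.

Section Multislice.
Variables (R : realType) (L : nat) (kappa : 'I_L -> nat) (x : 'I_L -> R).
Variable N : nat.

Definition multislice : {set {ffun 'I_N -> alphabet x}} :=
  [set w : {ffun 'I_N -> alphabet x} |
    [forall l : 'I_L, #|[set i | val (w i) == x l]| == kappa l]].

Definition multislice_prob (A : {set {ffun 'I_N -> alphabet x}}) : R :=
  #|multislice :&: A|%:R / #|multislice|%:R.

Variables (n : nat) (n_le_N : (n <= N)%N).

Definition pr (w : {ffun 'I_N -> alphabet x}) : {ffun 'I_n -> alphabet x} :=
  [ffun i => w (widen_ord n_le_N i)].

Definition multislice_pr : {set {ffun 'I_n -> alphabet x}} :=
  pr @: multislice.

Definition multislice_pr_prob (A : {set {ffun 'I_n -> alphabet x}}) : R :=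
  multislice_prob (pr @^-1: A).

Definition multislice_pr_expect (f : {ffun 'I_n -> alphabet x} -> R) : R :=
  \sum_(w in multislice_pr) f w * multislice_pr_prob [set w].

End Multislice.

(* For n = N the quotient in the exponent has a zero denominator (and would be
   0 here), so the limiting value is given separately. *)
Definition sampling_bound (R : realType) (n N : nat) (d t : R) : R :=
  if n == N then (if t == 0 then 1 else 0)
  else expR (- ((n%:R * t ^+ 2) / (4 * (1 - n%:R / N%:R) * d ^+ 2))).

(* Main.v *)
Require Import Defs.
From mathcomp Require Import all_boot all_order all_algebra all_fingroup.
From mathcomp Require Import ring lra zify.
From mathcomp Require Import unstable reals interval_inference.
From mathcomp Require Import topology normedtype derive convex sequences exp.

(** Drawing the coordinates of a uniform point of the multislice one at a time
is sampling without replacement from an urn of N letters, and the proof is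
Serfling's martingale argument.  Let mu be the mean of the urn and S_k the sum
of the first k draws, centred at mu.  Since S_N = 0, the N - k letters left
after k draws have mean mu - S_k / (N - k), and this is exactly what makes
M_k = S_k / (N - k) a martingale:

  M_(k+1) - M_k = (w_k - mean of the remaining letters) / (N - k - 1).

Given the past, w_k is uniform over the remaining letters.  In place of
conditional expectations the proof uses exchangeability: swapping coordinate k
with a coordinate j >= k preserves the uniform measure and fixes S_k, so the
factor of exp (l M_(k+1)) that involves w_k may be averaged over j >= k
([mgf_psum]).  Each average is bounded by Hoeffding's lemma for a finite
population ([sum_expR_range_le]), in the form exp (a^2 d^2 / 2) where d is the
range; it rests on convexity of exp and on cosh x <= exp (x^2 / 2)
([expR_chord], [cosh_le]).

The n increments contribute l^2 d^2 / 2 times the sum of 1 / j^2 over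
N - n <= j < N, and 1 / (2 j^2) <= 1 / j - 1 / (j + 1) bounds this by the
telescoping total l^2 d^2 (1 / (N - n) - 1 / N).  The Chernoff bound optimised over l
([card_psum_ge]) then gives exactly the exponent
n t^2 / (4 (1 - n / N) d^2).  The lower tail is the upper tail of the letters
with opposite values.  For n = N the deviation vanishes identically. *)

Set Implicit Arguments.
Unset Strict Implicit.
Unset Printing Implicit Defensive.

Import Order.TTheory GRing.Theory Num.Theory.
Import numFieldNormedType.Exports.

Local Open Scope ring_scope.

(** * Hoeffding's lemma for a finite population *)

Lemma ge0_of_derive (R : realType) (f g : R -> R) :
  (forall x, is_derive x (1:R) f (g x)) -> 0 <= f 0 ->
  (forall x, 0 <= x -> 0 <= g x) -> forall x, 0 <= x -> 0 <= f x.
Proof.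
move=> df f0 g0 x x0; apply: (le_trans f0).
apply: (@ger0_derive1_ndecr R f 0 x) => // [y|].
- rewrite in_itv/= => /andP[/ltW y0 _].
  by rewrite derive1E (@derive_val _ _ _ _ _ _ _ (df y)) g0.
- apply: derivable_within_continuous => y _; by case: (df y).
Qed.

(** Both sides are even.  The function 2 - (exp x + exp (- x)) exp (- x^2 / 2)
vanishes at 0; its derivative is 2 exp (- x^2 / 2) (x cosh x - sinh x), and
x cosh x - sinh x is nonnegative for x >= 0 because it vanishes at 0 and its
own derivative x sinh x is nonnegative. *)
Lemma cosh_le (R : realType) (x : R) : expR x + expR (- x) <= 2 * expR (x ^+ 2 / 2).
Proof.
wlog x0 : x / 0 <= x.
  move=> H; have [|/ltW x0] := leP 0 x; first exact: H.
  by rewrite -sqrrN -{1}[x]opprK [leLHS]addrC; rewrite H ?oppr_ge0// ?opprK.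
have sinh_le (y : R) : 0 <= y -> 0 <= (1 + y) * expR (- y) - (1 - y) * expR y.
  apply: (ge0_of_derive (f := fun y => (1 + y) * expR (- y) - (1 - y) * expR y)
    (g := fun y => y * (expR y - expR (- y)))).
  - move=> z; apply: is_derive_eq.
    rewrite /GRing.scale /=; ring.
  - by rewrite oppr0 expR0; lra.
  - by move=> z z0; rewrite mulr_ge0// subr_ge0 ler_expR; lra.
have : 0 <= 2 - (expR (x - x ^+ 2 / 2) + expR (- x - x ^+ 2 / 2)).
  apply: (ge0_of_derive
    (f := fun x => 2 - (expR (x - x ^+ 2 / 2) + expR (- x - x ^+ 2 / 2)))
    (g := fun x => expR (- (x ^+ 2 / 2)) *
                   ((1 + x) * expR (- x) - (1 - x) * expR x))) x0.
  - move=> z; apply: is_derive_eq.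
    rewrite /GRing.scale /= !expRD; by field.
  - rewrite expr0n/= mul0r oppr0 addr0 expR0; lra.
  - by move=> z z0; rewrite mulr_ge0 ?expR_ge0 ?sinh_le.
by rewrite subr_ge0 !expRD -mulrDl [expR (- (_ / _))]expRN ler_pdivrMr ?expR_gt0.
Qed.

(** Convexity of exp: on [- a d, a d] the graph lies below its chord.  The
bound is affine in y, so that it averages to its constant term, cosh (a d),
when y has mean zero. *)
Lemma expR_chord (R : realType) (a d y : R) : 0 < d -> `|y| <= d ->
  expR (a * y) <= (expR (a * d) + expR (- (a * d))) / 2 +
                  y * ((expR (a * d) - expR (- (a * d))) / (2 * d)).
Proof.
move=> d0 yd; have [y1 y2] : - d <= y /\ y <= d.
  by move: yd; rewrite ler_norml => /andP[].
have t0 : 0 <= (d + y) / (2 * d) by rewrite divr_ge0//; lra.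
have t1 : (d + y) / (2 * d) <= 1 by rewrite ler_pdivrMr; lra.
have := convex_expR (Itv01 t0 t1) (a * d) (- (a * d)).
rewrite !convRE /= /onem; congr (_ <= _); last by field; lra.
by congr expR; field; lra.
Qed.

Lemma sum_expR_le (R : realType) (J : finType) (D : {pred J})
    (y : J -> R) (a d : R) :
  \sum_(j in D) y j = 0 -> (forall j, j \in D -> `|y j| <= d) ->
  \sum_(j in D) expR (a * y j) <= #|D|%:R * expR (a ^+ 2 * d ^+ 2 / 2).
Proof.
move=> y0 yd; have [d0|d0] := ltP 0 d; last first.
  rewrite mulr_natl -sumr_const; apply: ler_sum => j jD.
  have -> : y j = 0.
    by apply/normr0_eq0/le_anti; rewrite normr_ge0 (le_trans (yd _ jD)).
  by rewrite ler_expR mulr0 mulr_ge0// mulr_ge0// sqr_ge0.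
apply: (le_trans (ler_sum _ (fun j jD => expR_chord a d0 (yd j jD)))).
rewrite big_split/= -[X in _ + X]mulr_suml y0 mul0r addr0 sumr_const.
rewrite -[leLHS]mulr_natl ler_wpM2l//.
have := cosh_le (a * d); rewrite exprMn; lra.
Qed.

(** The values and their average lie in the same interval, so the centred values
are at most its length in absolute value. *)
Lemma sum_expR_range_le (R : realType) (J : finType) (D : {pred J})
    (v : J -> R) (a lo hi : R) :
  (forall j, j \in D -> lo <= v j <= hi) ->
  \sum_(j in D) expR (a * (v j - (\sum_(i in D) v i) / #|D|%:R)) <=
    #|D|%:R * expR (a ^+ 2 * (hi - lo) ^+ 2 / 2).
Proof.
move=> vD; set avg := _ / _; have [D0|Dgt0] := posnP #|D|.
  by rewrite D0 mul0r big_pred0 // => j; apply/card0_eq.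
have cD0 : 0 < #|D|%:R :> R by rewrite ltr0n.
have avgE : #|D|%:R * avg = \sum_(j in D) v j by rewrite mulrC divfK ?gt_eqF.
have avg_lo : lo <= avg.
  by rewrite ler_pdivlMr// mulr_natr -sumr_const; apply: ler_sum => j /vD/andP[].
have avg_hi : avg <= hi.
  by rewrite ler_pdivrMr// mulr_natr -sumr_const; apply: ler_sum => j /vD/andP[].
apply: sum_expR_le => [|j /vD/andP[lo_v v_hi]].
  by rewrite sumrB sumr_const -mulr_natl avgE subrr.
rewrite ler_norml; apply/andP; split; lra.
Qed.

(** * Partial sums of an exchangeable family *)

Section Exchangeable.
Variables (R : realType) (T : finType) (N : nat) (Om : {set {ffun 'I_N -> T}}).

Definition swap (i j : 'I_N) (w : {ffun 'I_N -> T}) : {ffun 'I_N -> T} :=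
  [ffun k => w (tperm i j k)].

Hypothesis swapOm : forall i j w, w \in Om -> swap i j w \in Om.

Lemma swapK i j : involutive (swap i j).
Proof. by move=> w; apply/ffunP => k; rewrite !ffunE tpermK. Qed.

Lemma sum_swap i j (F : {ffun 'I_N -> T} -> R) :
  \sum_(w in Om) F w = \sum_(w in Om) F (swap i j w).
Proof.
rewrite (reindex_inj (inv_inj (swapK i j))); apply: eq_bigl => w.
by apply/idP/idP => /(swapOm i j)//; rewrite swapK.
Qed.

Variables (g : T -> R) (mu lo hi : R).
Hypothesis g_range : forall c, lo <= g c <= hi.
Hypothesis sum_g : forall w, w \in Om -> \sum_i g (w i) = N%:R * mu.

(** By exchangeability every coordinate has the same expectation, and these
expectations add up to N mu. *)
Lemma sum_first (i0 : 'I_N) : \sum_(w in Om) g (w i0) = #|Om|%:R * mu.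
Proof.
have N0 : N%:R != 0 :> R by rewrite pnatr_eq0 -lt0n (leq_ltn_trans _ (ltn_ord i0)).
apply: (mulfI N0).
have -> : N%:R * (\sum_(w in Om) g (w i0)) = \sum_(i < N) \sum_(w in Om) g (w i).
  have -> : N%:R = #|'I_N|%:R :> R by rewrite card_ord.
  rewrite mulr_natl -sumr_const; apply: eq_bigr => i _.
  by rewrite (sum_swap i0 i); apply: eq_bigr => w _; rewrite ffunE tpermL.
by rewrite exchange_big/= (eq_bigr _ sum_g) sumr_const -[LHS]mulr_natl mulrCA.
Qed.

Definition psum (k : nat) (w : {ffun 'I_N -> T}) : R :=
  \sum_(i < N | (i < k)%N) (g (w i) - mu).

Lemma card_head (k : nat) : (k <= N)%N -> #|[pred j : 'I_N | (j < k)%N]| = k.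
Proof.
move=> kN; rewrite -sum1_card (eq_bigl (fun j : 'I_N => (j < k)%N))//.
by rewrite (big_ord_narrow kN) sum1_card card_ord.
Qed.

Lemma card_tail (k : nat) : (k <= N)%N ->
  #|[pred j : 'I_N | (k <= j)%N]| = (N - k)%N.
Proof.
move=> kN; have := cardC [pred j : 'I_N | (j < k)%N].
rewrite card_head// card_ord => /(canRL (addKn _)) <-; apply: eq_card => j.
by rewrite !inE -leqNgt.
Qed.

(** Moment generating function of the martingale M_k = psum k / (N - k).  The
variance factor 1 / (N - k) - 1 / N grows by 1 / ((m + 1) m) from k to k + 1,
where m = N - k - 1, which dominates the contribution 1 / (2 m^2) of the new
increment because m >= 1. *)
Lemma mgf_psum (k : nat) (l : R) : (k < N)%N ->
  \sum_(w in Om) expR (l * psum k w / (N - k)%:R) <=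
  #|Om|%:R * expR (l ^+ 2 * (hi - lo) ^+ 2 * ((N - k)%:R^-1 - N%:R^-1)).
Proof.
elim: k => [|k IH] kN.
  rewrite mulr_natl -sumr_const; apply: ler_sum => w _.
  by rewrite /psum big_pred0// mulr0 mul0r subn0 subrr mulr0.
have {}IH := IH (ltnW kN).
pose D : {pred 'I_N} := [pred j : 'I_N | (k <= j)%N].
have cD : #|D| = (N - k)%N by exact/card_tail/ltnW/ltnW.
have m1 : 0 < (N - k.+1)%:R :> R by rewrite ltr0n subn_gt0.
have mE : (N - k)%:R = (N - k.+1)%:R + 1 :> R by rewrite natr1 subnSK// ltnW.
set m := (N - k.+1)%:R in m1 mE *.
pose k0 := Ordinal (ltnW kN).
have psumS w : psum k.+1 w = psum k w + (g (w k0) - mu).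
  rewrite /psum (bigD1 k0)/=; last by [].
  rewrite addrC; congr (_ + _); apply: eq_bigl => i.
  by rewrite ltnS -val_eqE/= ltn_neqAle andbC.
have psum_swap (j : 'I_N) w : (k <= j)%N -> psum k (swap k0 j w) = psum k w.
  move=> kj; apply: eq_bigr => i ik; rewrite ffunE tpermD//.
    by apply: contraTneq ik => <-; rewrite -leqNgt.
  by apply: contraTneq ik => <-; rewrite -leqNgt.
(* All N letters have mean mu, so the part psum k collected by the first k
   draws is missing from the remaining ones. *)
have avgE w : w \in Om ->
    (\sum_(j in D) g (w j)) / #|D|%:R = mu - psum k w / (N - k)%:R.
  move=> wOm; have : \sum_(j in D) g (w j) = (N - k)%:R * mu - psum k w.
    rewrite /psum sumrB sumr_const card_head; last exact/ltnW/ltnW.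
    have := sum_g wOm; rewrite (bigID (mem D))/= => /(canRL (addrK _)) ->.
    rewrite (eq_bigl (fun i : 'I_N => (i < k)%N)); last first.
      by move=> i; rewrite inE -ltnNge.
    by rewrite natrB; [ring | exact/ltnW/ltnW].
  by move=> ->; rewrite cD mulrBl mulrAC divff ?mul1r// mE gt_eqF// addr_gt0.
(* exp of l times the martingale increment, had the letter at j been drawn. *)
pose step (j : 'I_N) w :=
  expR (l / m * (g (w j) - (\sum_(j in D) g (w j)) / #|D|%:R)).
have stepE (j : 'I_N) : (k <= j)%N ->
    \sum_(w in Om) expR (l * psum k.+1 w / m) =
    \sum_(w in Om) expR (l * psum k w / (N - k)%:R) * step j w.
  move=> kj; rewrite (sum_swap k0 j); apply: eq_bigr => w wOm.
  rewrite psumS psum_swap// ffunE tpermL -expRD; congr expR.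
  rewrite avgE// mE; field. lra.
have -> : \sum_(w in Om) expR (l * psum k.+1 w / m) =
    (N - k)%:R^-1 *
    \sum_(w in Om) expR (l * psum k w / (N - k)%:R) * \sum_(j in D) step j w.
  under [in RHS]eq_bigr do rewrite mulr_sumr.
  rewrite exchange_big/=.
  rewrite [in RHS](eq_bigr (fun=> \sum_(w in Om) expR (l * psum k.+1 w / m))).
    by rewrite sumr_const cD -[X in _ * X]mulr_natl mulKf// mE gt_eqF// addr_gt0.
  by move=> j jD; rewrite (stepE j).
set B := expR ((l / m) ^+ 2 * (hi - lo) ^+ 2 / 2).
have step_le w : \sum_(j in D) step j w <= (N - k)%:R * B.
  by rewrite -cD; apply: sum_expR_range_le.
apply: (@le_trans _ _ (B * \sum_(w in Om) expR (l * psum k w / (N - k)%:R))).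
  rewrite -ler_pdivlMl ?invr_gt0; last by rewrite mE addr_gt0.
  rewrite invrK mulrA mulr_sumr; apply: ler_sum => w _.
  by rewrite mulrC ler_wpM2r ?expR_ge0.
apply: (le_trans (ler_wpM2l (expR_ge0 _) IH)).
rewrite mulrCA ler_wpM2l// -expRD ler_expR.
rewrite -subr_ge0 mE.
set C := l ^+ 2 * (hi - lo) ^+ 2.
have C0 : 0 <= C by rewrite mulr_ge0 ?sqr_ge0.
have m_ge1 : 1 <= m by rewrite ler1n subn_gt0.
set X := (X in 0 <= X).
have -> : X = C * ((m - 1) / (2 * m ^+ 2 * (m + 1))).
  rewrite /X /C; field.
  rewrite -/m -mE !pnatr_eq0 -!lt0n !subn_gt0 kN (ltnW kN).
  exact: (leq_ltn_trans (leq0n _) kN).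
rewrite mulr_ge0// divr_ge0//; first lra.
rewrite !mulr_ge0//; nra.
Qed.

Lemma psum_all w : w \in Om -> psum N w = 0.
Proof.
move=> wOm; rewrite /psum (eq_bigl xpredT) => [|i]; last by rewrite ltn_ord.
by rewrite sumrB sum_g// sumr_const card_ord mulr_natl subrr.
Qed.

(** Chernoff's method: Markov's inequality for exp (l M_n), whose moment
generating function is [mgf_psum]. *)
Lemma card_psum_ge (n : nat) (t : R) : (n < N)%N -> lo < hi -> 0 <= t ->
  #|[set w in Om | n%:R * t <= psum n w]|%:R <=
  #|Om|%:R * expR (- ((n%:R * t ^+ 2) / (4 * (1 - n%:R / N%:R) * (hi - lo) ^+ 2))).
Proof.
move=> nN lohi t0; set d := hi - lo; set A := [set w in Om | _].
have d0 : 0 < d by rewrite subr_gt0.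
have N0 : 0 < N%:R :> R by rewrite ltr0n (leq_ltn_trans _ nN).
have mE : (N - n)%:R = N%:R - n%:R :> R by rewrite natrB// ltnW.
have m0 : 0 < (N - n)%:R :> R by rewrite ltr0n subn_gt0.
set m := (N - n)%:R in mE m0.
(* This l minimises l^2 d^2 (1 / m - 1 / N) - l n t / m, as
   1 / m - 1 / N = n / (m N). *)
pose l := t * N%:R / (2 * d ^+ 2).
have l0 : 0 <= l by rewrite divr_ge0 ?mulr_ge0 ?sqr_ge0// ltW.
have chernoff : #|A|%:R * expR (l * (n%:R * t) / m) <=
    \sum_(w in Om) expR (l * psum n w / m).
  rewrite mulr_natl -sumr_const.
  apply: (@le_trans _ _ (\sum_(w in A) expR (l * psum n w / m))).
    apply: ler_sum => w; rewrite inE => /andP[_ wt].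
    by rewrite ler_expR ler_pM2r ?invr_gt0// ler_wpM2l.
  rewrite [leRHS](bigID (mem A))/= [X in _ <= X + _](eq_bigl (mem A)).
    by rewrite lerDl sumr_ge0// => w _; exact: expR_ge0.
  by move=> w; rewrite /= inE; case: (w \in Om).
have := le_trans chernoff (mgf_psum l nN).
rewrite -ler_pdivlMr ?expR_gt0// => /le_trans; apply.
rewrite -[leLHS]mulrA -expRB ler_wpM2l// ler_expR.
rewrite le_eqVlt; apply/orP; left; apply/eqP.
rewrite /l -/m mE -/d; field.
by rewrite -mE !gt_eqF.
Qed.

End Exchangeable.

(** * The multislice *)

Section MultisliceTail.
Variables (R : realType) (L : nat) (L_ge2 : (2 <= L)%N).
Variables (kappa : 'I_L -> nat) (x : 'I_L -> R).
Hypothesis x_incr : forall k l : 'I_L, (k < l)%N -> x k < x l.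

Lemma spread_gt0 : 0 < spread L_ge2 x.
Proof. by rewrite subr_gt0 x_incr//= -subn1 subn_gt0. Qed.

Lemma alphabet_range : exists lo hi, hi - lo = spread L_ge2 x /\
  forall c : alphabet x, lo <= val c <= hi.
Proof.
exists (x (Ordinal (ltnW L_ge2))), (x (Ordinal (etrans (ltn_predL L) (ltnW L_ge2)))).
have x_homo (k l : 'I_L) : (k <= l)%N -> x k <= x l.
  by rewrite leq_eqVlt => /predU1P[/ord_inj->//|/x_incr/ltW].
split=> // c; have /codomP[l ->] := valP c.
by rewrite !x_homo//=; have := ltn_ord l; lia.
Qed.

Variable N : nat.
Notation Om := (multislice kappa x N).

Lemma swap_multislice (i j : 'I_N) w : w \in Om -> swap i j w \in Om.
Proof.
rewrite !inE => /forallP wOm; apply/forallP => l; rewrite -(eqP (wOm l)).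
apply/eqP; rewrite -[RHS](card_preimset _ (@perm_inj _ (tperm i j))).
apply: eq_card => k.
by rewrite !inE ffunE.
Qed.

(** The letter x l occurs kappa l times in every point of the multislice, so
the sum of all coordinates does not depend on the point. *)
Lemma sum_multislice w : w \in Om -> \sum_i val (w i) = \sum_l (kappa l)%:R * x l.
Proof.
have x_inj : injective x.
  move=> k l xkl; have [/x_incr|/x_incr|/ord_inj//] := ltngtP k l.
    by rewrite xkl ltxx.
  by rewrite xkl ltxx.
rewrite inE => /forallP wOm.
transitivity (\sum_i \sum_l if val (w i) == x l then x l else 0).
  apply: eq_bigr => i _; have /codomP[l ->] := valP (w i).
  rewrite (bigD1 l)//= eqxx big1 ?addr0// => k kl.
  by rewrite (inj_eq x_inj) eq_sym (negPf kl).
rewrite exchange_big; apply: eq_bigr => l _.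
rewrite -big_mkcond/= sumr_const mulr_natl -(eqP (wOm l)).
by congr (_ *+ _); apply: eq_card => i; rewrite !inE.
Qed.

Variables (n : nat) (n_gt0 : (0 < n)%N) (n_le_N : (n <= N)%N).

(** Change of variables along the projection: its fibres partition the
multislice. *)
Lemma multislice_pr_expectE (f : {ffun 'I_n -> alphabet x} -> R) :
  multislice_pr_expect kappa n_le_N f =
  (\sum_(w in Om) f (pr n_le_N w)) / #|Om|%:R.
Proof.
rewrite /multislice_pr_expect (partition_big_imset (pr n_le_N))/= mulr_suml.
apply: eq_bigr => v _; rewrite /multislice_pr_prob /multislice_prob mulrA.
congr (_ / _); rewrite mulr_natr -sumr_const.
rewrite [RHS](eq_bigr (fun=> f v)) => [|w /andP[_ /eqP->//]].
by apply: eq_bigl => w; rewrite !inE.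
Qed.

Lemma psum_pr (f : alphabet x -> R) mu w :
  psum f mu n w = \sum_(i < n) f (pr n_le_N w i) - n%:R * mu.
Proof.
rewrite /psum (big_ord_narrow n_le_N) sumrB sumr_const card_ord mulr_natl.
by congr (_ - _); apply: eq_bigr => i _; rewrite ffunE.
Qed.

Definition letter_mean : R := (\sum_l (kappa l)%:R * x l) / N%:R.

Lemma expect_first : (0 < #|Om|)%N ->
  multislice_pr_expect kappa (x := x) n_le_N (fun v => val (v (Ordinal n_gt0))) =
  letter_mean.
Proof.
move=> Om0; rewrite multislice_pr_expectE.
under eq_bigr do rewrite ffunE.
rewrite (sum_first swap_multislice (g := val) (mu := letter_mean)).
  by rewrite mulrAC divff ?mul1r// pnatr_eq0 -lt0n.
move=> w /sum_multislice ->; rewrite mulrC divfK//.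
by rewrite pnatr_eq0 -lt0n (leq_trans n_gt0).
Qed.

(** One form for both tails: f is the value of a letter for the upper tail and
its opposite for the lower one. *)
Lemma multislice_pr_prob_le (f : alphabet x -> R) mu lo hi (t : R)
    (S : {set {ffun 'I_n -> alphabet x}}) :
    (forall c, lo <= f c <= hi) -> hi - lo = spread L_ge2 x ->
    (forall w, w \in Om -> \sum_i f (w i) = N%:R * mu) -> 0 <= t ->
    (forall w, w \in Om -> pr n_le_N w \in S -> n%:R * t <= psum f mu n w) ->
  multislice_pr_prob kappa n_le_N S <= sampling_bound n N (spread L_ge2 x) t.
Proof.
move=> f_range d_eq sum_f t0 S_dev.
have sub : (Om :&: (pr n_le_N @^-1: S)) \subset
    [set w in Om | n%:R * t <= psum f mu n w].
  apply/subsetP => w /setIP[wOm wS]; apply/setIdP; split=> //.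
  by apply: S_dev => //; move: wS; rewrite inE.
have bound0 : 0 <= sampling_bound n N (spread L_ge2 x) t.
  by rewrite /sampling_bound; case: ifP => _; [case: ifP | rewrite expR_ge0].
rewrite /multislice_pr_prob /multislice_prob.
(* An empty multislice gets probability 0, as 0^-1 = 0. *)
have [->|Om0] := posnP #|Om|; first by rewrite invr0 mulr0.
rewrite ler_pdivrMr ?ltr0n//.
apply: (@le_trans _ _ #|[set w in Om | n%:R * t <= psum f mu n w]|%:R).
  by rewrite ler_nat subset_leq_card.
rewrite /sampling_bound; case: eqP => [nN|/eqP nN]; last first.
  rewrite [leRHS]mulrC -d_eq; apply: card_psum_ge => //.
  - exact: swap_multislice.
  - by rewrite ltn_neqAle nN.
  - by rewrite -subr_gt0 d_eq spread_gt0.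
(* For n = N the sum is constant: a deviation t > 0 never occurs. *)
case: eqP => [_|/eqP t_neq0].
  by rewrite mul1r ler_nat subset_leq_card//; apply/subsetP => w /setIdP[].
rewrite mul0r eq_card0// => w; apply/negP => /setIdP[wOm].
rewrite nN (psum_all sum_f wOm) leNgt.
by rewrite mulr_gt0 ?lt_def ?t_neq0 ?t0 ?pnatr_eq0 ?ler0n -?lt0n -?nN ?n_gt0.
Qed.

End MultisliceTail.

Theorem corollary1p5 (R : realType) (L : nat) (L_ge2 : (2 <= L)%N)
    (kappa : 'I_L -> nat) (kappa_gt0 : forall l, (0 < kappa l)%N)
    (N : nat) (N_sum : N = (\sum_(l < L) kappa l)%N)
    (x : 'I_L -> R) (x_incr : forall k l : 'I_L, (k < l)%N -> x k < x l)
    (n : nat) (n_gt0 : (0 < n)%N) (n_le_N : (n <= N)%N)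
    (t : R) (t_ge0 : 0 <= t) :
  let P := multislice_pr_prob kappa (x := x) n_le_N in
  let E := multislice_pr_expect kappa (x := x) n_le_N in
  let dev (w : {ffun 'I_n -> alphabet x}) : R :=
    n%:R^-1 * (\sum_(i < n) val (w i)) - E (fun v => val (v (Ordinal n_gt0))) in
  P [set w in multislice_pr kappa x n_le_N | t <= dev w]
    <= sampling_bound n N (spread L_ge2 x) t /\
  P [set w in multislice_pr kappa x n_le_N | dev w <= - t]
    <= sampling_bound n N (spread L_ge2 x) t.
Proof.
move=> P E dev; set mu := letter_mean kappa x N.
have [lo [hi [d_eq val_range]]] := alphabet_range L_ge2 x_incr.
have n0 : 0 < n%:R :> R by rewrite ltr0n.
have sum_val (w : {ffun 'I_N -> alphabet x}) : w \in multislice kappa x N ->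
    \sum_i val (w i) = N%:R * mu.
  move=> /(sum_multislice x_incr) ->; rewrite mulrC divfK// pnatr_eq0 -lt0n.
  exact: (leq_trans n_gt0 n_le_N).
have devE (w : {ffun 'I_N -> alphabet x}) : w \in multislice kappa x N ->
    n%:R * dev (pr n_le_N w) = psum val mu n w.
  move=> wOm; rewrite /dev /E expect_first//; last by apply/card_gt0P; exists w.
  by rewrite (psum_pr n_le_N) mulrBr mulrA divff ?mul1r// gt_eqF.
split.
  apply: (multislice_pr_prob_le x_incr n_gt0 val_range d_eq sum_val t_ge0) => w wOm.
  by rewrite inE => /andP[_ tw]; rewrite -devE// ler_pM2l.
apply: (multislice_pr_prob_le (f := fun c => - val c) (mu := - mu)
    (lo := - hi) (hi := - lo) x_incr n_gt0 _ _ _ t_ge0) => [c||w wOm|w wOm].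
- by rewrite !lerN2 andbC.
- by rewrite -d_eq opprK addrC.
- by rewrite sumrN sum_val// mulrN.
- rewrite inE => /andP[_ tw].
  have -> : psum (fun c => - val c) (- mu) n w = - psum val mu n w.
    by rewrite /psum -sumrN; apply: eq_bigr => i _; rewrite opprD.
  by rewrite -devE// -mulrN ler_pM2l// lerNr.
Qed.
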